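(* Let $p$ be a prime, let $G$ be a non-abelian finite $p$-group, and let $n=d(Z(G))$. Let $N$ be a normal subgroup of $G$ such that $C_G(N)/Z(N)$ is cyclic and $$\mathrm{I}(C_G(N))\leq N\leq NC_G(N)\leq\Phi(G).$$ Then $\Omega_1(Z(NC_G(N)))\leq N$. Moreover, if $\mathrm{H}^1(G/NC_G(N),\Omega_1(Z(N)))\geq\mathbb{F}_p^{n+1}$, then $G$ has a non-inner automorphism of order $p$.
   Context: $Z(H)$ is the center, $\Phi(H)$ the Frattini subgroup, $C_G(N)$ the centralizer. $d(H)$ is defined by $|H/\Phi(H)|=p^{d(H)}$. $\Omega_1(H)=\langle x\in H\mid x^p=1\rangle$. For a subgroup $A$ of $G$, $\mathrm{I}(A)=\{g\in A\mid g^p\in Z(G)\}$. $\Omega_1(Z(N))$ is a $G/NC_G(N)$-module via conjugation $a^g=g^{-1}ag$, and $\mathrm{H}^1$ is ordinary group cohomology. For an elementary abelian $p$-group $H$, the notation $H\geq\mathbb{F}_p^m$ means $H\cong\mathbb{F}_p^t$ with $t\geq m$. *)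

(* Defs.v *)
From HB Require Import structures.
From mathcomp Require Import all_boot all_fingroup all_algebra all_solvable.

Set Implicit Arguments.
Unset Strict Implicit.
Unset Printing Implicit Defensive.

Import GroupScope.

(* The d with #|H / 'Phi(H)| = p ^ d, when H is a p-group. *)
Definition dgen (p : nat) (gT : finGroupType) (H : {set gT}) : nat :=
  logn p #|H / 'Phi(H)|.

Definition Iset (p : nat) (gT : finGroupType) (G A : {set gT}) : {set gT} :=
  [set g in A | g ^+ p \in 'Z(G)].

(* H is isomorphic to the additive group F_p ^ t for some t >= m. *)
Definition geFp (p : nat) (gT : finGroupType) (H : {set gT}) (m : nat) : Prop :=
  exists2 t : nat, m <= t & H \isog [set: 'rV['F_p]_t].

(* First cohomology of Q with coefficients in an abelian group M, written      *)
(* multiplicatively, on which Q acts on the right. Cochains are functions      *)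
(* [subg Q] -> rT, multiplied pointwise; all of them below take values in M.   *)
Section FirstCohomology.

Variables (aT rT : finGroupType) (D : {set aT}) (to : action D rT).
Variables (Q : {group aT}) (M : {group rT}).

Definition cochain1 := {dffun forall _ : [subg Q], rT}.

Definition Z1 : {set cochain1} :=
  [set f : cochain1 | [forall x, f x \in M] &&
     [forall x, forall y, f (x * y) == to (f x) (sgval y) * f y]].

Definition B1 : {set cochain1} :=
  [set ([ffun x => a^-1 * to a (sgval x)] : cochain1) | a in M].

Definition H1 : {set coset_of B1} := Z1 / B1.

Hypothesis abelM : abelian M.
Hypothesis actsQM : [acts Q, on M | to].
Hypothesis toM :
  forall a, a \in Q -> {in M &, {morph to^~ a : u v / u * v}}.

Let MC u v : u \in M -> v \in M -> u * v = v * u.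
Proof. by move=> Mu Mv; apply: (centsP abelM). Qed.

Let Mto u a : u \in M -> a \in Q -> to u a \in M.
Proof. by move=> Mu Qa; rewrite (acts_act actsQM). Qed.

Let to1 a : a \in Q -> to 1 a = 1.
Proof.
move=> Qa; apply: (@mulgI _ (to 1 a)).
by rewrite -toM ?group1 // !mulg1.
Qed.

Let toV u a : u \in M -> a \in Q -> to u^-1 a = (to u a)^-1.
Proof.
move=> Mu Qa; apply: (@mulgI _ (to u a)).
by rewrite -toM ?groupV // !mulgV to1.
Qed.

Lemma Z1P (f : cochain1) :
  reflect ((forall x, f x \in M)
           /\ (forall x y, f (x * y) = to (f x) (sgval y) * f y))
          (f \in Z1).
Proof.
rewrite inE; apply: (iffP andP) => [[/forallP Mf /forallP fM]|[Mf fM]].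
  by split=> // x y; apply/eqP/(forallP (fM x)).
by split; apply/forallP=> // x; apply/forallP=> y; apply/eqP.
Qed.

Lemma group_set_Z1 : group_set Z1.
Proof.
apply/group_setP; split=> [|f g /Z1P[Mf fM] /Z1P[Mg gM]]; apply/Z1P.
  by split=> [x|x y]; rewrite !oneg_ffun ?group1 // to1 ?mulg1 ?subgP.
split=> [x|x y]; rewrite !mulg_ffun ?groupM // fM gM toM ?subgP //.
rewrite -!mulgA; congr (_ * _); rewrite !mulgA; congr (_ * _).
by rewrite MC ?Mto ?subgP.
Qed.

Lemma group_set_B1 : group_set B1.
Proof.
apply/group_setP; split=> [|_ _ /imsetP[a Ma ->] /imsetP[b Mb ->]].
  apply/imsetP; exists 1; first exact: group1.
  by apply/ffunP=> x; rewrite oneg_ffun ffunE to1 ?subgP // invg1 mulg1.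
apply/imsetP; exists (a * b); first exact: groupM.
apply/ffunP=> x; rewrite mulg_ffun !ffunE toM ?subgP // (MC Ma Mb) invMg.
rewrite -!mulgA; congr (_ * _); rewrite !mulgA; congr (_ * _).
by rewrite MC ?groupV ?Mto ?subgP.
Qed.

Lemma sub_B1_Z1 : B1 \subset Z1.
Proof.
apply/subsetP=> _ /imsetP[a Ma ->]; apply/Z1P; split=> [x|x y]; rewrite !ffunE.
  by rewrite groupM ?groupV ?Mto ?subgP.
have QD: {subset Q <= D} := subsetP (acts_dom actsQM).
rewrite actMin ?QD ?subgP // toM ?groupV ?Mto ?subgP // toV ?subgP //.
by rewrite [RHS]MC ?groupM ?groupV ?Mto ?subgP // -mulgA mulKVg.
Qed.

Lemma abelian_Z1 : abelian Z1.
Proof.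
apply/centsP=> f /Z1P[Mf _] g /Z1P[Mg _].
by apply/ffunP=> x; rewrite !mulg_ffun MC.
Qed.

End FirstCohomology.

(* Main.v *)
Require Import Defs.
From mathcomp Require Import all_boot all_fingroup all_algebra all_solvable.

Set Implicit Arguments.
Unset Strict Implicit.
Unset Printing Implicit Defensive.

Import GroupScope.

(** Write C = C_G(N) and K = N C. Since Z(N) is central in C and C / Z(N) is
    cyclic, C is abelian; hence C = Z(K). An element of C of order dividing p
    has trivial p-th power, so it lies in I(C) <= N: this is the first claim,
    and it also gives Omega_1(Z(N)) = Omega_1(C). Call this module M.

    A 1-cocycle f : G / K -> M yields the automorphism g |-> g f(gK) of G
    ([cocycle_aut]). Because M is central in K and f is trivial on K, the k-th
    power of this automorphism is g |-> g f(gK)^k ([cocycle_autX]), so its p-th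
    power is the identity. Suppose now that every automorphism of order p is
    inner. Then the automorphism of f is conjugation by some x in G; x
    centralises K since f is trivial there, and x^p is in Z(G), so x lies in
    I(C). Solving g^x = g f(gK) shows that f is the coboundary of x^-1, an
    element of I(C) rather than of M ([cocycle_coboundary_Iset]). So H^1 is
    a subquotient of C: with delta : C -> cochains the coboundary morphism,
    whose kernel on C is Z(G),
      |H^1(G / K, M)| <= |delta(I(C))| / |delta(M)|.

    It remains to count. The p-th power morphism maps I(C) to Z(G) with kernel
    M, so |I(C)| <= |M| |Z(G)| and |delta(I(C))| <= |M|, while delta(M) has
    order |M| / |Omega_1(Z(G))|. Hence |H^1| <= |Omega_1(Z(G))|, which for an
    abelian p-group equals |Z(G) / Phi(Z(G))| = p^d(Z(G)) ([card_H1_le_fix],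
    [card_Ohm1_center]). A cohomology group of rank greater than d(Z(G))
    therefore forces a non-inner automorphism of order p. *)

(** * Coboundaries as a morphism *)

Section Coboundary.

Context {aT rT : finGroupType} {D : {set aT}} (to : action D rT).
Context (Q : {group aT}) (C : {group rT}).

(** The formula of a 1-coboundary, but for elements c of a module C that may be
    larger than the coefficient module of the cohomology. *)
Definition coboundary (c : rT) : cochain1 rT Q :=
  [ffun x => c^-1 * to c (sgval x)].

Hypothesis abelC : abelian C.
Hypothesis actsQC : [acts Q, on C | to].
Hypothesis toM : forall a, a \in Q -> {in C &, {morph to^~ a : u v / u * v}}.

Lemma coboundaryM : {in C &, {morph coboundary : c d / c * d}}.
Proof.
move=> c d Cc Cd; have CM := centsP abelC.
apply/ffunP=> x; rewrite mulg_ffun !ffunE toM ?subgP // (CM _ Cc _ Cd) invMg.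
rewrite -!mulgA; congr (_ * _); rewrite !mulgA; congr (_ * _).
by apply: CM; rewrite ?groupV // (acts_act actsQC) ?subgP.
Qed.

Canonical coboundary_morphism := Morphism coboundaryM.

Lemma ker_coboundary : 'ker coboundary = 'Fix_(C | to)(Q).
Proof.
apply/setP=> c; apply/idP/setIP=> [/morphpreP[Cc /set1P dc1] | [Cc /afixP fixc]].
  split=> //; apply/afixP=> a Qa.
  have := congr1 (fun f : cochain1 rT Q => f (subg Q a)) dc1.
  by rewrite oneg_ffun !ffunE subgK // => /(canRL (mulKVg _)); rewrite mulg1.
apply/kerP=> //; apply/ffunP=> x; rewrite oneg_ffun ffunE fixc ?subgP //.
exact: mulVg.
Qed.

Lemma B1_coboundary (M : {group rT}) :
  M \subset C -> B1 to Q M = coboundary @* M.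
Proof. by move=> sMC; rewrite morphimEsub. Qed.

End Coboundary.

(** * The order of the first cohomology group *)

Lemma card_morphim_ker (aT rT : finGroupType) (D A : {group aT})
    (f : {morphism D >-> rT}) :
  A \subset D -> (#|f @* A| * #|'ker_A f|)%N = #|A|.
Proof.
by move=> sAD; rewrite card_morphim (setIidPr sAD) mulnC LagrangeI.
Qed.

Lemma group_set_H1 (aT rT : finGroupType) (D : {set aT}) (to : action D rT)
    (Q : {group aT}) (M : {group rT}) :
    abelian M -> [acts Q, on M | to] ->
    (forall a, a \in Q -> {in M &, {morph to^~ a : u v / u * v}}) ->
  group_set (H1 to Q M).
Proof.
move=> abelM actsQM toM.
exact: (groupP (Group (group_set_Z1 abelM actsQM toM)
                  / Group (group_set_B1 abelM actsQM toM))%G).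
Qed.

Lemma card_H1 (aT rT : finGroupType) (D : {set aT}) (to : action D rT)
    (Q : {group aT}) (M : {group rT}) :
    abelian M -> [acts Q, on M | to] ->
    (forall a, a \in Q -> {in M &, {morph to^~ a : u v / u * v}}) ->
  (#|H1 to Q M| * #|B1 to Q M|)%N = #|Z1 to Q M|.
Proof.
move=> abelM actsQM toM.
pose Z := Group (group_set_Z1 abelM actsQM toM).
pose B := Group (group_set_B1 abelM actsQM toM).
have sBZ: B \subset Z := sub_B1_Z1 abelM actsQM toM.
have nBZ: Z \subset 'N(B) by apply: sub_abelian_norm => //; apply: abelian_Z1.
by rewrite mulnC -[RHS](Lagrange sBZ) -(card_quotient nBZ).
Qed.

(** If the cocycles with values in M become coboundaries of elements of I in the
    larger module C, then H^1 has at most |delta(I)| / |delta(M)| elements,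
    where delta(A) has order |A| / |C_A(Q)|; the size bound on I bounds this
    quotient by |C_M(Q)|. *)
Lemma card_H1_le_fix (aT rT : finGroupType) (D : {set aT}) (to : action D rT)
    (Q : {group aT}) (M I C : {group rT}) :
    abelian C -> [acts Q, on C | to] -> [acts Q, on M | to] ->
    (forall a, a \in Q -> {in C &, {morph to^~ a : u v / u * v}}) ->
    M \subset C -> I \subset C -> Z1 to Q M \subset coboundary to Q @: I ->
    #|I| <= #|M| * #|'Fix_(I | to)(Q)| ->
  #|H1 to Q M| <= #|'Fix_(M | to)(Q)|.
Proof.
move=> abelC actsC actsM toC sMC sIC sZdI leI.
pose delta := coboundary_morphism abelC actsC toC.
have kerE (A : {group rT}) : A \subset C -> 'ker_A delta = 'Fix_(A | to)(Q).
  by move=> sAC; rewrite ker_coboundary setIA (setIidPl sAC).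
have abelM := abelianS sMC abelC.
have toM a : a \in Q -> {in M &, {morph to^~ a : u v / u * v}}.
  by move=> Qa; apply: sub_in2 (toC a Qa); apply/subsetP.
have cardH1 := card_H1 abelM actsM toM.
have cardB: #|B1 to Q M| = #|delta @* M|.
  by rewrite (B1_coboundary abelC actsC toC sMC).
rewrite cardB in cardH1.
have cardM := card_morphim_ker delta sMC.
have cardI := card_morphim_ker delta sIC.
rewrite kerE // in cardM; rewrite kerE // in cardI.
have leZ : #|Z1 to Q M| <= #|delta @* I|.
  by rewrite subset_leq_card // morphimEsub.
rewrite -(leq_pmul2r (cardG_gt0 (delta @* M))) cardH1 (leq_trans leZ) //.
rewrite -cardI -cardM leq_pmul2r in leI; first by rewrite mulnC.
by rewrite -kerE ?cardG_gt0.
Qed.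

Lemma card_isog_geFp (p : nat) (gT : finGroupType) (H : {set gT}) m :
  prime p -> group_set H -> geFp p H m -> p ^ m <= #|H|.
Proof.
move=> p_pr gH [t le_mt isoH].
rewrite (@card_isog _ _ (Group gH) _ isoH) cardsT card_mx mul1n card_Fp //.
by rewrite leq_pexp2l ?prime_gt0.
Qed.

(** * Automorphisms defined by cocycles of G / K *)

Section Inflation.

Context {gT : finGroupType} {G K : {group gT}}.
Hypothesis nsKG : K <| G.

Let nKG g : g \in G -> g \in 'N(K).
Proof. exact: (subsetP (normal_norm nsKG)). Qed.

Lemma modJE c g :
  c \in 'C(K) -> g \in G -> ('J %% K)%act c (coset K g) = c ^ g.
Proof.
by move=> cKc Gg; rewrite /= modactE ?in_setT ?nKG // setTI afixJ.
Qed.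

Lemma modJM (C : {group gT}) Kg :
    C \subset 'C(K) -> Kg \in G / K ->
  {in C &, {morph ('J %% K)%act^~ Kg : c d / c * d}}.
Proof.
move=> /subsetP cKC /morphimP[g _ Gg ->] c d Cc Cd.
by rewrite !modJE ?conjMg ?cKC ?groupM.
Qed.

Lemma acts_modJ (C : {group gT}) :
  C \subset 'C(K) -> G \subset 'N(C) -> [acts G / K, on C | 'J %% K].
Proof.
by move=> cKC nCG; rewrite astabs_mod ?astabJ 1?centsC // astabsJ quotientS.
Qed.

Lemma fix_modJ (C : {group gT}) :
  C \subset 'C(K) -> 'Fix_(C | 'J %% K)(G / K) = 'C_C(G).
Proof.
move=> cKC; rewrite afix_mod ?astabJ 1?centsC ?afixJ // setTI.
exact: normal_norm.
Qed.

Definition inflation (f : cochain1 gT (G / K)) g : gT :=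
  f (subg (G / K) (coset K g)).

Context {M : {group gT}} {f : cochain1 gT (G / K)}.
Hypotheses (sMZ : M \subset 'Z(K)) (Zf : f \in Z1 ('J %% K) (G / K) M).

Let sMK : M \subset K := subset_trans sMZ (center_sub K).
Let cKM : M \subset 'C(K) := subset_trans sMZ (subsetIr _ _).

Lemma inflation_in g : inflation f g \in M.
Proof. by case/Z1P: Zf => Mf _; apply: Mf. Qed.

Lemma inflationM :
  {in G &, forall g h, inflation f (g * h) = inflation f g ^ h * inflation f h}.
Proof.
move=> g h Gg Gh; case/Z1P: Zf => Mf fM.
rewrite /inflation morphM ?nKG // subgM ?mem_quotient // fM.
by rewrite subgK ?mem_quotient // modJE // (subsetP cKM).
Qed.

Lemma inflation1 k : k \in K -> inflation f k = 1.
Proof.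
move=> Kk; have ->: inflation f k = inflation f 1.
  by rewrite /inflation !coset_id.
apply: (@mulgI _ (inflation f 1)); have := @inflationM 1 1 (group1 G) (group1 G).
by rewrite conjg1 !mulg1 => <-.
Qed.

Lemma inflationMr g k :
  g \in G -> k \in K -> inflation f (g * k) = inflation f g.
Proof.
move=> Gg Kk; have Gk := subsetP (normal_sub nsKG) k Kk.
rewrite inflationM // (inflation1 Kk) mulg1.
by apply/conjg_fixP/commgP/(centsP cKM); rewrite ?inflation_in.
Qed.

(** The cocycle identity says exactly that g |-> g f(gK) is a morphism. An
    element g of its kernel is the inverse of f(gK), so it lies in M <= K, where
    f is trivial; hence g = 1. *)
Lemma cocycle_aut :
  exists2 a, a \in Aut G & {in G, forall g, a g = g * inflation f g}.
Proof.
pose a g := g * inflation f g; have sKG := subsetP (normal_sub nsKG).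
have aM: {in G &, {morph a : g h / g * h}}.
  move=> g h Gg Gh; rewrite /a inflationM // -!mulgA; congr (_ * _).
  by rewrite mulKVg.
pose am := Morphism aM.
have inj_a: 'injm am.
  apply/subsetP=> g /morphpreP[Gg /set1P gfg1]; apply/set1P.
  have Kg: g \in K.
    by rewrite -groupV (mulg1_eq gfg1) (subsetP sMK) ?inflation_in.
  by move: gfg1; rewrite /= /a inflation1 ?mulg1.
have im_a: am @* G = G.
  apply/(morphim_fixP inj_a) => //; apply/subsetP=> _ /morphimP[g _ Gg ->] /=.
  by rewrite groupM // sKG // (subsetP sMK) ?inflation_in.
exists (aut inj_a im_a); first exact: Aut_aut.
by move=> g Gg; rewrite autE.
Qed.

(** Multiplying g by an element of K does not change f(gK), so each iteration
    contributes one more factor f(gK). *)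
Lemma cocycle_autX (a : {perm gT}) k :
    {in G, forall g, a g = g * inflation f g} ->
  {in G, forall g, (a ^+ k) g = g * inflation f g ^+ k}.
Proof.
move=> aE g Gg; elim: k => [|k IHk]; first by rewrite perm1 mulg1.
have Kfk: inflation f g ^+ k \in K by rewrite groupX ?(subsetP sMK) ?inflation_in.
have Gfk := subsetP (normal_sub nsKG) _ Kfk.
rewrite expgSr permM IHk aE ?groupM // (inflationMr Gg Kfk).
by rewrite -mulgA -expgSr.
Qed.

Lemma inner_cocycle_cent x :
  {in G, forall g, g ^ x = g * inflation f g} -> x \in 'C(K).
Proof.
move=> xE; apply/centP=> k Kk; apply/esym/commgP/conjg_fixP.
by rewrite xE ?inflation1 ?mulg1 ?(subsetP (normal_sub nsKG)).
Qed.

(** From g^x = g f(gK) one gets f(gK) = (x^-1)^g x, and x commutes with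
    f(gK) because it centralises K; moving x to the left gives x (x^-1)^g. *)
Lemma inner_cocycleE x :
    {in G, forall g, g ^ x = g * inflation f g} ->
  f = coboundary ('J %% K) (G / K) x^-1.
Proof.
move=> xE; have cKx := inner_cocycle_cent xE; apply/ffunP=> q.
have /morphimP[g _ Gg qE] := subgP q.
have ->: f q = inflation f g by rewrite /inflation -qE sgvalK.
rewrite ffunE qE invgK modJE ?groupV //.
have cxf: commute x (inflation f g).
  by apply: (centP cKx); rewrite (subsetP sMK) ?inflation_in.
apply: (mulIg x); rewrite -cxf -mulgA; congr (_ * _).
by apply: (mulgI g); rewrite -xE // !conjgE !mulgA mulgV mul1g.
Qed.

(** The conjugating element x satisfies x^p in Z(G) because the automorphism
    of f, having trivial p-th power, is conjugation by x. *)
Lemma cocycle_coboundary_Iset (p : nat) :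
    {in M, forall m, m ^+ p = 1} ->
    {in Aut G, forall a, a ^+ p = 1 -> a \in conj_aut G @* G} ->
  f \in coboundary ('J %% K) (G / K) @: Iset p G 'C_G(K).
Proof.
move=> Mp1 inner_p; have [a AutGa aE] := cocycle_aut.
have ap1: a ^+ p = 1.
  apply: (eq_Aut (groupX p AutGa) (group1 _)) => g Gg.
  by rewrite (cocycle_autX p aE) // perm1 Mp1 ?inflation_in ?mulg1.
have /morphimP[x nGx Gx aJx] := inner_p a AutGa ap1.
have xE: {in G, forall g, g ^ x = g * inflation f g}.
  by move=> g Gg; rewrite -aE // aJx conj_autE.
apply/imsetP; exists x^-1; last exact: inner_cocycleE.
rewrite inE groupV inE Gx (inner_cocycle_cent xE) expgVn groupV inE groupX //=.
by rewrite -(ker_conj_aut G); apply/kerP; rewrite ?groupX // morphX // -aJx.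
Qed.

End Inflation.

(** * Elements with central p-th power in an abelian subgroup *)

Section AbelianSubgroup.

Context {p : nat} {gT : finGroupType} {G C : {group gT}}.
Hypotheses (pG : p.-group G) (sCG : C \subset G) (abelC : abelian C).

Let pC : p.-group C := pgroupS sCG pG.

Lemma Ohm1_abelianP x :
  reflect (x \in C /\ x ^+ p = 1) (x \in 'Ohm_1(C)).
Proof.
rewrite (OhmEabelian pC) ?(abelianS (Ohm_sub _ _)) // expn1; exact: LdivP.
Qed.

Let expM : {in C &, {morph (fun c => c ^+ p) : c d / c * d}}.
Proof. by move=> c d Cc Cd; apply/expgMn/(centsP abelC). Qed.

Let exp_morphism := Morphism expM.

Lemma group_set_Iset : group_set (Iset p G C).
Proof.
suff ->: Iset p G C = exp_morphism @*^-1 'Z(G) by apply: groupP.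
by apply/setP=> c; rewrite !inE.
Qed.

Canonical Iset_group := Group group_set_Iset.

Lemma sub_Iset : Iset p G C \subset C.
Proof. by apply/subsetP=> c /setIdP[]. Qed.

(** The p-th power morphism sends I(C) into Z(G), which is C_I(G) when C
    contains Z(G), and its kernel is Omega_1(C). *)
Lemma card_Iset :
  'Z(G) \subset C -> #|Iset p G C| <= #|'Ohm_1(C)| * #|'C_(Iset p G C)(G)|.
Proof.
move=> sZC; rewrite -(card_morphim_ker exp_morphism sub_Iset) mulnC leq_mul //.
  apply/subset_leq_card/subsetP=> c /setIP[_ /morphpreP[Cc /set1P cp1]].
  exact/Ohm1_abelianP.
apply/subset_leq_card/subsetP=> _ /morphimP[c _ /setIdP[_ Zcp] ->] /=.
rewrite inE; have [_ ->] := setIP Zcp.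
by rewrite andbT inE (subsetP sZC) // groupX.
Qed.

End AbelianSubgroup.

Lemma cent_Ohm1_abelian (p : nat) (gT : finGroupType) (G C : {group gT}) :
    p.-group G -> C \subset G -> abelian C -> 'Z(G) \subset C ->
  'C_('Ohm_1(C))(G) = 'Ohm_1('Z(G)).
Proof.
move=> pG sCG abelC sZC; apply/eqP.
rewrite eqEsubset [X in _ && X]subsetI OhmS //= andbC.
rewrite (subset_trans (Ohm_sub _ _)) ?subsetIr //=.
apply/subsetP=> x /setIP[/(Ohm1_abelianP pG sCG abelC)[Cx xp1] cGx].
apply/(Ohm1_abelianP pG (center_sub G) (center_abelian G)); split=> //.
by rewrite inE (subsetP sCG).
Qed.

(** In an abelian p-group A, Phi(A) is the image of the p-th power map and
    Omega_1(A) is its kernel. *)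
Lemma card_Ohm1_center (p : nat) (gT : finGroupType) (G : {group gT}) :
  p.-group G -> #|'Ohm_1('Z(G))| = (p ^ dgen p 'Z(G))%N.
Proof.
move=> pG; have pZ := pgroupS (center_sub G) pG; have abZ := center_abelian G.
rewrite /dgen -card_pgroup ?quotient_pgroup // card_quotient ?gFnorm //.
rewrite -divgS ?Phi_sub //= (Phi_Mho pZ abZ).
by rewrite -(mul_card_Ohm_Mho_abelian 1 abZ) mulnK ?cardG_gt0.
Qed.


(** * Non-inner automorphisms of order p *)

Theorem theorem2p5 (p : nat) (gT : finGroupType) (G N : {group gT}) :
  prime p -> p.-group G -> ~~ abelian G ->
  N <| G -> cyclic ('C_G(N) / 'Z(N)) ->
  [&& Iset p G 'C_G(N) \subset N,
      N \subset N <*> 'C_G(N) & N <*> 'C_G(N) \subset 'Phi(G)] ->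
  'Ohm_1('Z(N <*> 'C_G(N))) \subset N /\
  (geFp p (H1 ('J %% (N <*> 'C_G(N))) (G / (N <*> 'C_G(N))) 'Ohm_1('Z(N)))
     (dgen p 'Z(G)).+1 ->
   exists2 f : {perm gT},
     f \in Aut G :\: conj_aut G @* G & #[f] = p).
Proof.
move=> p_pr pG _ nsNG cycCZ /and3P[sIN _ _].
set C := 'C_G(N)%G; set K := (N <*> C)%G.
have sNG := normal_sub nsNG; have nNG := normal_norm nsNG.
have sCG: C \subset G := subsetIl _ _.
have nsCG: C <| G by rewrite /normal sCG normsI ?normG ?norms_cent.
have nsKG: K <| G by rewrite normalY.
have cNC: C \subset 'C(N) := subsetIr _ _.
have sZNC: 'Z(N) \subset C by rewrite setSI.
have abelC: abelian C.
  apply: cyclic_factor_abelian cycCZ.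
  by rewrite subsetI sZNC centsC (subset_trans cNC) // centS ?center_sub.
have defZK: 'Z(K) = C.
  apply/eqP; rewrite eqEsubset [in X in _ && X]subsetI joing_subr centsC.
  rewrite join_subG.
  rewrite -[abelian C]/(C \subset 'C(C)) in abelC.
  rewrite abelC centsC cNC !andbT; apply: setISS; first exact: normal_sub.
  by rewrite centS ?joing_subl.
have Ohm1N: 'Ohm_1(C) \subset N.
  apply: subset_trans sIN; apply/subsetP=> x.
  case/(Ohm1_abelianP pG sCG abelC)=> Cx xp1.
  by rewrite inE Cx xp1 group1.
have defM: 'Ohm_1('Z(N)) = 'Ohm_1(C).
  apply/eqP; rewrite eqEsubset OhmS //= -{1}Ohm_id OhmS // subsetI Ohm1N.
  exact: subset_trans (Ohm_sub _ _) cNC.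
split; first by rewrite -[_ <*> _]/(gval K) defZK.
set M := 'Ohm_1('Z(N))%G => H1_ge.
have sMC: M \subset C by rewrite /= defM Ohm_sub.
have sMZK: M \subset 'Z(K) by rewrite defZK.
have cKC: C \subset 'C(K) by rewrite -defZK subsetIr.
have cKM := subset_trans sMC cKC.
have nMG: G \subset 'N(M) by rewrite !gFnorm_trans.
have defCK: 'C_G(K) = C.
  by apply/eqP; rewrite eqEsubset setIS ?centS ?joing_subl // subsetI sCG.
have sZC: 'Z(G) \subset C by rewrite setIS ?centS.
case: (pickP [pred f : {perm gT} |
    (f \in Aut G :\: conj_aut G @* G) && (#[f] == p)]) => [f /andP[? /eqP]|].
  by exists f.
move=> no_outer.
have inner_p: {in Aut G, forall a, a ^+ p = 1 -> a \in conj_aut G @* G}.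
  move=> a AutGa ap1; apply: contraFT (no_outer a) => outer_a.
  rewrite /= inE outer_a AutGa /=; apply/eqP/nt_prime_order => //.
  by apply: contraNneq outer_a => ->; apply: group1.
have abelM := abelianS sMC abelC.
have actsM: [acts G / K, on M | 'J %% K] by rewrite acts_modJ.
have gH1 := group_set_H1 abelM actsM (fun a => @modJM _ _ _ nsKG M a cKM).
suff leH1: #|H1 ('J %% K) (G / K) M| <= p ^ dgen p 'Z(G).
  have := leq_trans (card_isog_geFp p_pr gH1 H1_ge) leH1.
  by rewrite leq_exp2l ?prime_gt1 // ltnn.
rewrite -(card_Ohm1_center pG) -(cent_Ohm1_abelian pG sCG abelC sZC).
rewrite -[X in 'C_X(G)]defM -(fix_modJ nsKG cKM).
apply: (@card_H1_le_fix _ _ _ _ _ _ (@Iset_group p gT G C abelC) C) => //.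
- by rewrite acts_modJ ?normal_norm.
- by move=> a; apply: modJM.
- exact: sub_Iset.
- apply/subsetP=> f Zf; rewrite -[gval (Iset_group _)]/(Iset p G C) -defCK.
  apply: (cocycle_coboundary_Iset nsKG sMZK Zf) inner_p => m.
  by rewrite /= defM => /(Ohm1_abelianP pG sCG abelC)[].
rewrite fix_modJ ?(subset_trans _ cKC) ?sub_Iset //= defM.
exact: card_Iset.
Qed.
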